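(* $J_n$ is the unique Chebyshev center of $\Omega_n$ relative to the metric space $(M_n(\mathbb{R}), \|\cdot\|_{\mathcal{S}_1})$ (i.e. the unique $A\in M_n(\mathbb{R})$ minimizing $\sup_{B\in\Omega_n}\|A-B\|_{\mathcal{S}_1}$), and the corresponding Chebyshev radius is $$ \inf_{A\in M_n(\mathbb{R})}\sup_{B\in\Omega_n}\|A-B\|_{\mathcal{S}_1} = n-1. $$
   Context: $\Omega_n$ denotes the set of $n\times n$ doubly stochastic matrices (nonnegative real entries, all row and column sums equal to $1$). $J_n$ is the $n\times n$ matrix with all entries equal to $1/n$. $\|A\|_{\mathcal{S}_1} := \sum_{i=1}^n\sigma_i(A)$ is the Schatten 1-norm (trace norm), where $\sigma_i(A)$ are the singular values of $A$. Given a constraint set $\mathcal{R}\subseteq M_n(\mathbb{R})$ and a norm, the Chebyshev radius of $\Omega_n$ is $\inf_{A\in\mathcal{R}}\sup_{B\in\Omega_n}\|A-B\|$ and a Chebyshev center is any $A\in\mathcal{R}$ attaining this infimum; ''relative to the metric space $(M_n(\mathbb{R}),\|\cdot\|)$'' means $\mathcal{R}=M_n(\mathbb{R})$. *)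

(* Defs.v *)
From HB Require Import structures.
From mathcomp Require Import all_boot all_order all_algebra.
From mathcomp Require Import classical_sets reals.
Set Implicit Arguments. Unset Strict Implicit. Unset Printing Implicit Defensive.
Import Order.TTheory GRing.Theory Num.Theory.
Local Open Scope ring_scope.
Local Open Scope classical_set_scope.

Definition doubly_stochastic (R : realType) (n : nat) (B : 'M[R]_n) : Prop :=
  (forall i j, 0 <= B i j) /\
  (forall i, \sum_j B i j = 1) /\
  (forall j, \sum_i B i j = 1).

Definition Jmat (R : realType) (n : nat) : 'M[R]_n := const_mx (n%:R)^-1.

Definition orthogonal_mx (R : realType) (n : nat) (U : 'M[R]_n) : Prop :=
  U *m U^T = 1%:M.

Definition is_singular_values (R : realType) (n : nat) (A : 'M[R]_n)
    (s : 'rV[R]_n) : Prop :=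
  (forall i, 0 <= s 0 i) /\
  exists U V : 'M[R]_n, orthogonal_mx U /\ orthogonal_mx V /\
    A = U *m diag_mx s *m V.

(* the singular values of A (chosen via an SVD; they exist and are unique
   up to permutation) *)
Definition singular_values (R : realType) (n : nat) (A : 'M[R]_n) : 'rV[R]_n :=
  xget 0 [set s | is_singular_values A s].

Definition schatten1 (R : realType) (n : nat) (A : 'M[R]_n) : R :=
  \sum_i singular_values A 0 i.

Definition cheb_dev (R : realType) (n : nat) (A : 'M[R]_n) : R :=
  sup [set schatten1 (A - B) | B in [set B : 'M[R]_n | doubly_stochastic B]].

Definition cheb_radius (R : realType) (n : nat) : R :=
  inf [set @cheb_dev R n A | A in [set: 'M[R]_n]].

(* Main.v *)
Require Import Defs.
From HB Require Import structures.
From mathcomp Require Import all_boot all_order all_algebra.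
From mathcomp Require Import perm spectral sesquilinear complex ring lra.
From mathcomp Require Import classical_sets reals.
Import Order.TTheory GRing.Theory Num.Theory.
Local Open Scope ring_scope.
Set Implicit Arguments.
Unset Strict Implicit.
Unset Printing Implicit Defensive.

(** By the singular value decomposition, the trace norm of [A] is the maximum of
    [tr (A W)] over orthogonal [W].

    Upper bound at [J]: with the projection [C = 1 - J] one has
    [tr ((J - B) W) = - tr ((W C) (B C))], and both factors have squared Frobenius
    norm at most [tr C = n - 1], because a doubly stochastic [B] is a contraction.

    Lower bound: for a permutation matrix [P], testing [A - P] against
    [- P^T (1 - 2 v v^T / |v|^2)] and against [- P^T] bounds the norm from below;
    averaging over cyclic shifts of [P], with [v] the all-ones vector, turns
    [tr (A P^T)] into [S / n], where [S] is the sum of the entries of [A], and gives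
    [n - S / n] and [n - 2 + S / n], whose mean is [n - 1].

    Uniqueness: if [A] attains [n - 1] then [S = n], hence [tr (A P^T) = 1] for all
    [P], and the reflections give [v^T A P^T v <= |v|^2] for all [v]. This is an
    equality at [v = 1], so the derivative there vanishes, which says that every
    row sum plus every column sum of [A] is 2. Hence all of them are 1, and
    comparing [tr (A P^T)] for permutations differing by a transposition yields
    [A = J]. *)

(** Over the complex extension the matrix is Hermitian, so the spectral theorem supplies a real
    eigenvalue. It is a root of the characteristic polynomial, whose coefficients lie in [R], hence
    it already has an eigenvector over [R]. *)
Lemma symmetric_eigenvector (R : rcfType) (n : nat) (S : 'M[R]_n.+1) :
  S^T = S -> exists (a : R) (v : 'rV[R]_n.+1), v != 0 /\ v *m S = a *: v.
Proof.
move=> symS; pose f := real_complex R; pose C := map_mx f S.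
have hermC : C \is hermitianmx _ false Num.conj.
  apply/is_hermitianmxP; rewrite expr0 scale1r.
  by apply/matrixP=> i j; rewrite !mxE -[in LHS]symS mxE; exact/esym/conjc_real.
have /orthomx_spectralP spec := hermitian_normalmx hermC.
have := mxOverP (hermitian_spectral_diag_real hermC) 0 0.
move=> /complex_realP[a da].
have unitP := spectral_unit C.
have eigC : eigenvalue C (f a).
  apply/eigenvalueP; exists (row 0 (spectralmx C)).
    rewrite -row_mul {2}spec !mulmxA mulmxV // mul1mx.
    by apply/rowP => j; rewrite mxE mul_diag_mx !mxE da.
  apply/negP=> /eqP r0; have := row_mul 0 (spectralmx C) (invmx (spectralmx C)).
  rewrite r0 mul0mx mulmxV // => /rowP/(_ 0).
  by rewrite !mxE eqxx => /eqP; rewrite oner_eq0.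
exists a; move: eigC; rewrite eigenvalue_root_char -map_char_poly fmorph_root.
rewrite -eigenvalue_root_char => /eigenvalueP[v vS v0].
by exists v.
Qed.

(** * Dot products and reflections *)

Section Dot.
Context {R : realType} {n : nat}.
Implicit Types u v w : 'rV[R]_n.

Definition dot u v : R := \sum_i u 0 i * v 0 i.

Lemma dotE u v : u *m v^T = (dot u v)%:M.
Proof.
apply/matrixP=> i j; rewrite !ord1 !mxE mulr1n.
by apply: eq_bigr => k _; rewrite mxE.
Qed.

Lemma dotC u v : dot u v = dot v u.
Proof. by apply: eq_bigr => i _; rewrite mulrC. Qed.

Lemma dotDl u v w : dot (u + v) w = dot u w + dot v w.
Proof. by rewrite -big_split; apply: eq_bigr => i _; rewrite !mxE mulrDl. Qed.

Lemma dotZl (a : R) u v : dot (a *: u) v = a * dot u v.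
Proof. by rewrite /dot mulr_sumr; apply: eq_bigr => i _; rewrite !mxE mulrA. Qed.

Lemma dotDr u v w : dot u (v + w) = dot u v + dot u w.
Proof. by rewrite !(dotC u) dotDl. Qed.

Lemma dotZr (a : R) u v : dot u (a *: v) = a * dot u v.
Proof. by rewrite !(dotC u) dotZl. Qed.

Lemma dot_ge0 u : 0 <= dot u u.
Proof. by apply: sumr_ge0 => i _; rewrite -expr2 sqr_ge0. Qed.

Lemma dot_eq0 u : (dot u u == 0) = (u == 0).
Proof.
apply/eqP/eqP => [u0|->]; last by rewrite /dot big1 // => i _; rewrite mxE mul0r.
apply/rowP=> i; rewrite mxE; apply/eqP; rewrite -sqrf_eq0 expr2.
move/eqP: u0; rewrite psumr_eq0 => [/allP/(_ i)|j _]; last by rewrite -expr2 sqr_ge0.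
by rewrite mem_index_enum; apply.
Qed.

Lemma dot_gt0 u : u != 0 -> 0 < dot u u.
Proof. by move=> u0; rewrite lt0r dot_eq0 u0 dot_ge0. Qed.

Lemma dot_mull u v (A : 'M[R]_n) : dot (u *m A) v = dot u (v *m A^T).
Proof.
have /matrixP/(_ 0 0) : (u *m A) *m v^T = u *m (v *m A^T)^T.
  by rewrite trmx_mul trmxK mulmxA.
by rewrite !dotE !mxE.
Qed.

Lemma exists_unit_multiple u : u != 0 -> exists a : R, dot (a *: u) (a *: u) = 1.
Proof.
move=> u0; exists (Num.sqrt (dot u u))^-1; rewrite dotZl dotZr mulrA -invfM -expr2.
by rewrite sqr_sqrtr ?dot_ge0 // mulVf // dot_eq0.
Qed.

Definition reflection v : 'M[R]_n := 1%:M - (2 / dot v v) *: (v^T *m v).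

Lemma mul_reflection u v : u *m reflection v = u - (2 * dot u v / dot v v) *: v.
Proof.
rewrite mulmxBr mulmx1 -scalemxAr mulmxA dotE mul_scalar_mx scalerA.
by congr (_ - _ *: _); ring.
Qed.

Lemma reflection_sym v : (reflection v)^T = reflection v.
Proof. by rewrite /reflection linearB linearZ /= trmx1 trmx_mul trmxK. Qed.

Lemma reflection_orth v : v != 0 -> orthogonal_mx (reflection v).
Proof.
move=> v0; rewrite /orthogonal_mx reflection_sym.
apply/row_matrixP=> i; rewrite row_mul rowE mul_reflection mul_reflection.
rewrite dotDl -scaleNr dotZl -addrA -scalerBl.
have d0 : dot v v != 0 by rewrite dot_eq0.
rewrite rowE mulmx1 -[RHS]addr0; congr (_ + _).
by rewrite -[RHS](scale0r v); congr (_ *: _); field.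
Qed.
End Dot.

Lemma orthogonal_mx1 (R : realType) n : orthogonal_mx (1%:M : 'M[R]_n).
Proof. by rewrite /orthogonal_mx trmx1 mulmx1. Qed.

Lemma orthogonal_mxT (R : realType) n (U : 'M[R]_n) :
  orthogonal_mx U -> orthogonal_mx U^T.
Proof. by rewrite /orthogonal_mx trmxK => /mulmx1C. Qed.

Lemma orthogonal_mxM (R : realType) n (U V : 'M[R]_n) :
  orthogonal_mx U -> orthogonal_mx V -> orthogonal_mx (U *m V).
Proof.
move=> oU oV; rewrite /orthogonal_mx trmx_mul mulmxA -(mulmxA U) oV mulmx1.
exact: oU.
Qed.

Lemma orthogonal_mxN (R : realType) n (U : 'M[R]_n) :
  orthogonal_mx U -> orthogonal_mx (- U).
Proof. by rewrite /orthogonal_mx linearN /= mulNmx mulmxN opprK. Qed.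

(** The Householder reflection along [e - u] exchanges the unit vectors [e] and [u]. It degenerates
    when [u = e], where the identity serves instead. *)
Lemma orthogonal_mx_of_unit_vector (R : realType) n (u : 'rV[R]_n.+1) :
  dot u u = 1 -> exists2 H : 'M[R]_n.+1, orthogonal_mx H & row 0 H = u.
Proof.
move=> u1; pose e : 'rV[R]_n.+1 := delta_mx 0 0.
have [->|une] := eqVneq u e.
  by exists 1%:M; [exact: orthogonal_mx1 | rewrite rowE mulmx1].
have w0 : e - u != 0 by rewrite subr_eq0 eq_sym.
exists (reflection (e - u)); first exact: reflection_orth.
rewrite rowE mul_reflection.
have e1 : dot e e = 1.
  rewrite /dot (bigD1 0) //= big1 ?mxE /= ?addr0 ?mulr1 // => i i0.
  by rewrite !mxE (negbTE i0) andbF mul0r.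
have := w0; rewrite -dot_eq0.
(* This makes the coefficient of [e - u] in the reflected vector equal to 1, so [e] goes to
   [e - (e - u) = u]. *)
have -> : dot (e - u) (e - u) = 2 * dot e (e - u).
  rewrite -scaleN1r !(dotDl, dotDr, dotZl, dotZr) u1 e1 (dotC u e); ring.
by move=> d0; rewrite divff // scale1r opprB addrC subrK.
Qed.

(** * Singular values and the trace norm *)

(** Take [v] a unit eigenvector of [A *m A^T]; its eigenvalue is [a = |v A|^2], so [s] is the square
    root of [a] and [u] is [v A] divided by [s]. *)
Lemma exists_singular_pair (R : realType) n (A : 'M[R]_n.+1) :
  exists (s : R) (u v : 'rV[R]_n.+1),
    [/\ 0 <= s, dot u u = 1, dot v v = 1, v *m A = s *: u & u *m A^T = s *: v].
Proof.
have [a [v0 [v0n0 vA0]]] : exists (a : R) (v : 'rV[R]_n.+1),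
    v != 0 /\ v *m (A *m A^T) = a *: v.
  by apply: symmetric_eigenvector; rewrite trmx_mul trmxK.
have [b] := exists_unit_multiple v0n0; set v := b *: v0 => v1.
have vA : v *m A *m A^T = a *: v.
  by rewrite -mulmxA /v -scalemxAl vA0 !scalerA mulrC.
have normvA : dot (v *m A) (v *m A) = a.
  by rewrite dot_mull vA dotZr v1 mulr1.
have a_ge0 : 0 <= a by rewrite -normvA dot_ge0.
exists (Num.sqrt a).
(* If [a = 0] then [v A = 0] cannot be normalized. But [A] is then singular, hence so is [A^T], and
   any unit vector killed by [A^T] can be [u]. *)
have [a0|a0] := eqVneq a 0.
  have vA00 : v *m A = 0 by apply/eqP; rewrite -dot_eq0 normvA a0.
  have vn0 : v != 0 by rewrite -dot_eq0 v1 oner_eq0.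
  have : \det A^T == 0 by rewrite det_tr; apply/det0P; exists v.
  case/det0P=> w wn0 wA; have [c c1] := exists_unit_multiple wn0.
  exists (c *: w), v; split => //; rewrite ?sqrtr_ge0 // a0 sqrtr0 scale0r //.
  by rewrite -scalemxAl wA scaler0.
have s0 : Num.sqrt a != 0 by rewrite sqrtr_eq0 -ltNge lt0r a0.
have ss : a = Num.sqrt a * Num.sqrt a by rewrite -expr2 sqr_sqrtr.
exists ((Num.sqrt a)^-1 *: (v *m A)), v; split => //.
- exact: sqrtr_ge0.
- by rewrite dotZl dotZr normvA {3}ss mulrA -invfM mulVf // mulf_neq0.
- by rewrite scalerA divff // scale1r.
- by rewrite -scalemxAl vA {2}ss scalerA mulKf.
Qed.

Lemma mulmx_block_diag (R : realType) m n (A B : 'M[R]_m) (C D : 'M[R]_n) :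
  block_mx A 0 0 C *m block_mx B 0 0 D = block_mx (A *m B) 0 0 (C *m D).
Proof. by rewrite mulmx_block !mulmx0 !mul0mx !addr0 add0r. Qed.

(* Deflation: orthogonal matrices whose first rows are a singular pair bring A to
   the form diag (s, A'). *)
Lemma svd_exists (R : realType) n (A : 'M[R]_n) :
  exists s : 'rV[R]_n, is_singular_values A s.
Proof.
elim: n A => [|n IHn] A.
  exists 0; split => [i|]; first by rewrite mxE.
  exists 1%:M, 1%:M; split; first exact: orthogonal_mx1.
  by split; [exact: orthogonal_mx1 | apply/matrixP=> -[]].
have [s [u [v [s_ge0 u1 v1 vA uA]]]] := exists_singular_pair A.
have [H oH rH] := orthogonal_mx_of_unit_vector v1.
have [K oK rK] := orthogonal_mx_of_unit_vector u1.
have [B defB] : exists B : 'M[R]_(1 + n), B = H *m A *m K^T by exists (H *m A *m K^T).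
have rowB : row 0 B = s *: delta_mx 0 0.
  rewrite defB !row_mul rH vA -rK -scalemxAl -row_mul oK.
  by rewrite rowE mulmx1.
have colB : row 0 B^T = s *: delta_mx 0 0.
  rewrite defB !trmx_mul trmxK mulmxA !row_mul rK uA -rH -scalemxAl -row_mul oH.
  by rewrite rowE mulmx1.
have [d [d_ge0 [U [V [oU [oV dB]]]]]] := IHn (drsubmx B).
have BE : B = block_mx s%:M 0 0 (drsubmx B).
  rewrite -[LHS]submxK; congr block_mx; apply/matrixP=> i j; rewrite !mxE ?ord1.
  - move/rowP/(_ 0): rowB; rewrite !mxE /= mulr1 => <-;
    congr (B _ _); exact: val_inj.
  - move/rowP/(_ (rshift 1 j)): rowB; rewrite !mxE /= mulr0 => <-;
    congr (B _ _); exact: val_inj.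
  - move/rowP/(_ (rshift 1 i)): colB; rewrite !mxE /= mulr0 => <-;
    congr (B _ _); exact: val_inj.
pose blk (X : 'M[R]_n) : 'M[R]_(1 + n) := block_mx 1%:M 0 0 X.
have oblk X : orthogonal_mx X -> orthogonal_mx (blk X).
  move=> oX; rewrite /orthogonal_mx /blk tr_block_mx !trmx0 trmx1 mulmx_block.
  by rewrite !mulmx0 !mul0mx !mulmx1 oX !addr0 add0r -scalar_mx_block.
exists (row_mx s%:M d); split.
  by move=> i; rewrite mxE; case: split => j //; rewrite ord1 mxE mulr1n.
exists (H^T *m blk U), (blk V *m K); split.
  by apply: orthogonal_mxM; [exact: orthogonal_mxT | exact: oblk].
split; first by apply: orthogonal_mxM; [exact: oblk|].
have -> : diag_mx (row_mx s%:M d) = block_mx s%:M 0 0 (diag_mx d) :> 'M[R]_(1 + n).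
  rewrite diag_mx_row; congr block_mx.
  by apply/matrixP=> i j; rewrite !ord1 !mxE.
rewrite BE dB in defB.
have -> : A = H^T *m (H *m A *m K^T) *m K.
  by rewrite -!mulmxA (mulmx1C oK) mulmx1 mulmxA (mulmx1C oH) mul1mx.
have factB : block_mx s%:M 0 0 (U *m diag_mx d *m V) =
    blk U *m block_mx (s%:M : 'M_1) 0 0 (diag_mx d) *m blk V.
  by rewrite /blk !mulmx_block_diag mul1mx mulmx1.
by rewrite -defB factB !mulmxA.
Qed.

Lemma orthogonal_mx_row (R : realType) n (U : 'M[R]_n) i :
  orthogonal_mx U -> dot (row i U) (row i U) = 1.
Proof.
move=> /matrixP/(_ i i); rewrite !mxE eqxx mulr1n => <-.
by apply: eq_bigr => k _; rewrite !mxE.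
Qed.

Lemma orthogonal_mx_entry (R : realType) n (U : 'M[R]_n) i j :
  orthogonal_mx U -> `|U i j| <= 1.
Proof.
move=> oU; rewrite -(@ler_pXn2r _ 2) ?nnegrE // expr1n real_normK ?num_real //.
rewrite -(orthogonal_mx_row i oU) /dot (bigD1 j) //= mxE -expr2 lerDl.
by apply: sumr_ge0 => k _; rewrite -expr2 sqr_ge0.
Qed.

Lemma singular_valuesP (R : realType) n (A : 'M[R]_n) :
  is_singular_values A (singular_values A).
Proof. by have := xgetPex 0 (svd_exists A). Qed.

(** Cycling the factors of the decomposition turns the trace into that of [diag_mx s] times an
    orthogonal matrix, whose diagonal entries are at most 1. *)
Lemma trace_le_schatten1 (R : realType) n (A W : 'M[R]_n) :
  orthogonal_mx W -> \tr (A *m W) <= schatten1 A.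
Proof.
move=> oW; have [s_ge0 [U [V [oU [oV {1}->]]]]] := singular_valuesP A.
rewrite /schatten1; set s := singular_values A in s_ge0 *.
rewrite -!mulmxA mxtrace_mulC -!mulmxA.
apply: ler_sum => i _; rewrite mul_diag_mx mxE ler_piMr // .
apply: le_trans (ler_norm _) _; apply: orthogonal_mx_entry.
by do 2?apply: orthogonal_mxM.
Qed.

Lemma schatten1_eq_trace (R : realType) n (A : 'M[R]_n) :
  exists2 W : 'M[R]_n, orthogonal_mx W & schatten1 A = \tr (A *m W).
Proof.
have [s_ge0 [U [V [oU [oV AE]]]]] := singular_valuesP A.
(* The inverse of the orthogonal polar factor [U *m V] of [A]. *)
exists (V^T *m U^T).
  by apply: orthogonal_mxM; apply: orthogonal_mxT.
rewrite AE mulmxA -[_ *m V *m V^T]mulmxA oV mulmx1 mxtrace_mulC mulmxA.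
by rewrite (mulmx1C oU) mul1mx mxtrace_diag /schatten1 -AE.
Qed.

(** * Doubly stochastic matrices *)

Definition frobenius_sqr (R : realType) n (X : 'M[R]_n) : R :=
  \sum_i \sum_j X i j ^+ 2.

Lemma frobenius_sqrE (R : realType) n (X : 'M[R]_n) :
  frobenius_sqr X = \tr (X *m X^T).
Proof.
by apply: eq_bigr => i _; rewrite mxE; apply: eq_bigr => j _; rewrite mxE expr2.
Qed.

(** The arithmetic mean loses nothing against Cauchy-Schwarz later on, where both factors have the
    same bound [n - 1]. *)
Lemma trace_mul_le_frobenius (R : realType) n (X Y : 'M[R]_n) :
  \tr (X *m Y) <= (frobenius_sqr X + frobenius_sqr Y) / 2.
Proof.
rewrite [frobenius_sqr Y]exchange_big /= -big_split /= mulr_suml.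
apply: ler_sum => i _; rewrite mxE -big_split /= mulr_suml.
apply: ler_sum => j _; have := sqr_ge0 (X i j - Y j i); nra.
Qed.

(** Each row of [B] is a probability vector, so Jensen's inequality bounds the square of an entry of
    [B *m Y] by an average of squares. Summing over the rows, the column sums of [B] remove the
    weights. *)
Lemma frobenius_sqr_doubly_stochastic (R : realType) n (B Y : 'M[R]_n) :
  doubly_stochastic B -> frobenius_sqr (B *m Y) <= frobenius_sqr Y.
Proof.
move=> [B_ge0 [rowB colB]]; rewrite /frobenius_sqr.
rewrite exchange_big /= [leRHS]exchange_big /=.
apply: ler_sum => k _.
have jensen i : (B *m Y) i k ^+ 2 <= \sum_j B i j * Y j k ^+ 2.
  set m := (B *m Y) i k.
  (* Jensen's inequality for squares: the variance of column [k] of [Y] under the weights [B i j] is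
     nonnegative. *)
  have : 0 <= \sum_j B i j * (Y j k - m) ^+ 2.
    by apply: sumr_ge0 => j _; rewrite mulr_ge0 ?sqr_ge0.
  suff -> : \sum_j B i j * (Y j k - m) ^+ 2 = \sum_j B i j * Y j k ^+ 2 - m ^+ 2.
    by rewrite subr_ge0.
  have -> : \sum_j B i j * (Y j k - m) ^+ 2 =
      \sum_j B i j * Y j k ^+ 2 - 2 * m * (\sum_j B i j * Y j k) +
      m ^+ 2 * \sum_j B i j.
    rewrite !mulr_sumr -sumrB -big_split /=; apply: eq_bigr => j _; ring.
  rewrite rowB; have -> : \sum_j B i j * Y j k = m by rewrite /m mxE.
  ring.
apply: le_trans (ler_sum _ (fun i _ => jensen i)) _.
rewrite exchange_big /=; apply: ler_sum => j _.
by rewrite -mulr_suml colB mul1r.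
Qed.

Lemma mulmx_Jmat (R : realType) n (B : 'M[R]_n) :
  doubly_stochastic B -> B *m Jmat R n = Jmat R n.
Proof.
move=> [_ [rowB _]]; apply/matrixP=> i j; rewrite !mxE.
by under eq_bigr do rewrite mxE; rewrite -mulr_suml rowB mul1r.
Qed.

Lemma Jmat_mulmx (R : realType) n (B : 'M[R]_n) :
  doubly_stochastic B -> Jmat R n *m B = Jmat R n.
Proof.
move=> [_ [_ colB]]; apply/matrixP=> i j; rewrite !mxE.
by under eq_bigr do rewrite mxE; rewrite -mulr_sumr colB mulr1.
Qed.

Lemma Jmat_doubly_stochastic (R : realType) n :
  (0 < n)%N -> doubly_stochastic (Jmat R n).
Proof.
move=> n0; split=> [i j|]; first by rewrite mxE invr_ge0 ler0n.
split=> i; under eq_bigr do rewrite mxE;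
  by rewrite sumr_const card_ord -[_ *+ n]mulr_natr mulVf // pnatr_eq0 -lt0n.
Qed.

Lemma perm_mx_doubly_stochastic (R : realType) n (s : 'S_n) :
  doubly_stochastic (perm_mx s : 'M[R]_n).
Proof.
split=> [i j|]; first by rewrite !mxE ler0n.
split=> [i|j].
  rewrite (bigD1 (s i)) //= big1 ?mxE ?mxE ?eqxx ?addr0 // => j sij.
  by rewrite !mxE eq_sym (negbTE sij).
rewrite (bigD1 (s^-1%g j)) //= big1 ?mxE ?mxE ?permKV ?eqxx ?addr0 // => i sij.
rewrite !mxE (_ : (s i == j) = false) //; apply: contraNF sij => /eqP <-.
by rewrite permK.
Qed.

(** * The upper bound at [Jmat] *)

Lemma schatten1_Jmat_sub (R : realType) n (B : 'M[R]_n) : (0 < n)%N ->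
  doubly_stochastic B -> schatten1 (Jmat R n - B) <= n%:R - 1.
Proof.
move=> n0 dsB; have dsJ := Jmat_doubly_stochastic R n0.
pose C : 'M[R]_n := 1%:M - Jmat R n.
have CT : C^T = C by rewrite /C linearB /= trmx1 trmx_const.
have CC : C *m C = C.
  by rewrite {2}/C mulmxBr mulmx1 /C mulmxBl mul1mx (mulmx_Jmat dsJ) subrr subr0.
have trC : \tr C = n%:R - 1.
  rewrite linearB /= mxtrace1; congr (_ - _).
  have [_ [/(_ (Ordinal n0)) <- _]] := dsJ.
  by apply: eq_bigr => i _; rewrite !mxE.
have BC : B *m C = B - Jmat R n by rewrite mulmxBr mulmx1 mulmx_Jmat.
have CBC : C *m (B *m C) = B - Jmat R n.
  by rewrite BC mulmxBl mul1mx mulmxBr Jmat_mulmx // Jmat_mulmx // subrr subr0.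
have [W oW ->] := schatten1_eq_trace (Jmat R n - B).
(* The second copy of [C] goes to [W]: this lowers the squared Frobenius norm of that factor from
   [n] to [n - 1]. *)
have -> : \tr ((Jmat R n - B) *m W) = \tr (- (W *m C) *m (B *m C)).
  by rewrite mulNmx -mulmxA CBC mxtrace_mulC -mulmxN opprB.
apply: le_trans (trace_mul_le_frobenius _ _) _.
have fC : frobenius_sqr C = n%:R - 1 by rewrite frobenius_sqrE CT CC.
have := frobenius_sqr_doubly_stochastic C dsB; rewrite fC.
suff -> : frobenius_sqr (- (W *m C)) = n%:R - 1 by lra.
rewrite frobenius_sqrE linearN /= mulNmx mulmxN opprK trmx_mul CT mulmxA.
by rewrite -(mulmxA W) CC mxtrace_mulC mulmxA (mulmx1C oW) mul1mx.
Qed.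

(** * Lower bounds from permutation matrices *)

Lemma mulmx_tr_perm_mxE (R : realType) n (A : 'M[R]_n) (s : 'S_n) i j :
  (A *m (perm_mx s)^T) i j = A i (s j).
Proof. by rewrite tr_perm_mx -col_permE mxE. Qed.

Lemma perm_mx_orth (R : realType) n (s : 'S_n) :
  orthogonal_mx (perm_mx s : 'M[R]_n).
Proof. by rewrite /orthogonal_mx tr_perm_mx -perm_mxM mulgV perm_mx1. Qed.

Lemma schatten1_sub_perm_ge (R : realType) n (A : 'M[R]_n) (s : 'S_n) :
  n%:R - \sum_i A i (s i) <= schatten1 (A - perm_mx s).
Proof.
have oP := perm_mx_orth R s.
apply: le_trans (trace_le_schatten1 _ (orthogonal_mxN (orthogonal_mxT oP))).
rewrite mulmxN mulmxBl oP opprB linearB /= mxtrace1.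
rewrite lerD2l lerN2; apply: ler_sum => i _; by rewrite mulmx_tr_perm_mxE.
Qed.

(** Scaling by [dot v v] clears the denominator of the reflection. The bound is then polynomial in
    [v] and also covers [v = 0], so it can be perturbed freely. *)
Lemma schatten1_sub_perm_reflection_ge (R : realType) n (A : 'M[R]_n) (s : 'S_n)
    (v : 'rV[R]_n) :
  dot v v * (n%:R - 2 - \sum_i A i (s i)) +
    2 * (\sum_i \sum_j v 0 i * A i (s j) * v 0 j)
  <= dot v v * schatten1 (A - perm_mx s).
Proof.
have [->|v0] := eqVneq v 0.
  rewrite (_ : dot 0 0 = 0); last by apply/eqP; rewrite dot_eq0.
  rewrite !mul0r add0r big1 ?mulr0 // => i _; rewrite big1 // => j _.
  by rewrite !mxE mulr0.
have d0 := dot_gt0 v0; have oP := perm_mx_orth R s.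
have oW := orthogonal_mxN (orthogonal_mxM (orthogonal_mxT oP) (reflection_orth v0)).
have := trace_le_schatten1 (A - perm_mx s) oW.
rewrite -(ler_pM2l d0); apply: le_trans.
set Q := \sum_i \sum_j _.
have rank1 (M : 'M[R]_n) : \tr (M *m (v^T *m v)) = dot (v *m M) v.
  by rewrite mulmxA mxtrace_mulC mulmxA dotE mxtrace_scalar mulr1n.
have trH (M : 'M[R]_n) : dot v v * \tr (M *m reflection v) =
    dot v v * \tr M - 2 * dot (v *m M) v.
  rewrite mulmxBr mulmx1 linearB /= -scalemxAr linearZ /= rank1; field.
  by rewrite gt_eqF.
have -> : \tr ((A - perm_mx s) *m - ((perm_mx s)^T *m reflection v)) =
    \tr (1%:M *m reflection v) - \tr (A *m (perm_mx s)^T *m reflection v).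
  by rewrite mulmxN mulmxA mulmxBl oP mulmxBl opprB linearB.
rewrite [leRHS]mulrBr !trH mulmx1 mxtrace1.
have -> : \tr (A *m (perm_mx s)^T) = \sum_i A i (s i).
  by apply: eq_bigr => i _; rewrite mulmx_tr_perm_mxE.
have -> : dot (v *m (A *m (perm_mx s)^T)) v = Q.
  rewrite /Q exchange_big; apply: eq_bigr => j _; rewrite mxE mulr_suml.
  by apply: eq_bigr => i _; rewrite mulmx_tr_perm_mxE.
lra.
Qed.

(* The permutations i |-> s (k + i) hit every entry of A exactly once. *)
Lemma sum_shift (R : realType) n (A : 'M[R]_n.+1) (s : 'S_n.+1) :
  \sum_k \sum_i A i ((perm (addrI k) * s)%g i) = \sum_i \sum_j A i j.
Proof.
rewrite exchange_big; apply: eq_bigr => i _.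
rewrite [RHS](reindex_inj (@perm_inj _ s)) [RHS](reindex_inj (addIr i)) /=.
by apply: eq_bigr => k _; rewrite permM permE.
Qed.

(** Needed for [sup] in [cheb_dev] to be a genuine supremum. Entries of [B] and of the orthogonal
    [W] are at most 1 in absolute value, which gives a crude entrywise bound. *)
Lemma has_ubound_schatten1_doubly_stochastic (R : realType) n (A : 'M[R]_n) :
  has_ubound [set schatten1 (A - B) | B in [set B | doubly_stochastic B]]%classic.
Proof.
exists (\sum_i \sum_j (`|A i j| + 1)) => _ [B [B_ge0 [rowB colB]] <-].
have [W oW ->] := schatten1_eq_trace (A - B).
apply: ler_sum => i _; rewrite mxE; apply: ler_sum => j _.
apply: le_trans (ler_norm _) _; rewrite normrM -[leRHS]mulr1.
apply: ler_pM => //; last exact: orthogonal_mx_entry.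
rewrite !mxE; apply: le_trans (ler_normB _ _) _; rewrite lerD2l ger0_norm //.
by rewrite -(rowB i) (bigD1 j) //= lerDl sumr_ge0.
Qed.

Lemma schatten1_sub_le_cheb_dev (R : realType) n (A B : 'M[R]_n) :
  doubly_stochastic B -> schatten1 (A - B) <= cheb_dev A.
Proof.
move=> dsB; apply: ub_le_sup; first exact: has_ubound_schatten1_doubly_stochastic.
by exists B.
Qed.

Lemma cheb_dev_Jmat_le (R : realType) n : (0 < n)%N ->
  cheb_dev (Jmat R n) <= n%:R - 1.
Proof.
move=> n0; apply: ge_sup.
  by exists (schatten1 (Jmat R n - Jmat R n)), (Jmat R n) => //;
    exact: Jmat_doubly_stochastic.
by move=> _ [B dsB <-]; exact: schatten1_Jmat_sub.
Qed.

(** * Deviation from the permutation matrices *)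

Section Deviation.
Context {R : realType} {n : nat}.
Implicit Types (A : 'M[R]_n.+1) (s : 'S_n.+1).

Lemma cheb_dev_perm_ge A s : n.+1%:R - \sum_i A i (s i) <= cheb_dev A.
Proof.
apply: le_trans (schatten1_sub_perm_ge A s) _.
exact/schatten1_sub_le_cheb_dev/perm_mx_doubly_stochastic.
Qed.

Lemma cheb_dev_reflection_ge A s (v : 'rV[R]_n.+1) :
  dot v v * (n.+1%:R - 2 - \sum_i A i (s i)) +
    2 * (\sum_i \sum_j v 0 i * A i (s j) * v 0 j)
  <= dot v v * cheb_dev A.
Proof.
apply: le_trans (schatten1_sub_perm_reflection_ge A s v) _.
apply: ler_wpM2l; first exact: dot_ge0.
exact/schatten1_sub_le_cheb_dev/perm_mx_doubly_stochastic.
Qed.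

Lemma sum_const_ord (c : R) : \sum_(k < n.+1) c = n.+1%:R * c.
Proof. by rewrite sumr_const card_ord mulr_natl. Qed.

Let total A := \sum_i \sum_j A i j.

Lemma cheb_dev_total_ge A : n.+1%:R - total A / n.+1%:R <= cheb_dev A.
Proof.
have n0 : 0 < n.+1%:R :> R by rewrite ltr0n.
rewrite -(ler_pM2l n0) mulrBr mulrCA divff ?gt_eqF // mulr1.
have : \sum_(k < n.+1) (n.+1%:R - \sum_i A i ((perm (addrI k) * 1)%g i)) <=
   \sum_(k < n.+1) cheb_dev A by apply: ler_sum => k _; exact: cheb_dev_perm_ge.
by rewrite sumrB sum_shift !sum_const_ord.
Qed.

Lemma sum_const_form A s : \sum_i \sum_j 1 * A i (s j) * 1 = total A.
Proof.
apply: eq_bigr => i _; rewrite [RHS](reindex_inj (@perm_inj _ s)) /=.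
by apply: eq_bigr => j _; rewrite mul1r mulr1.
Qed.

Lemma cheb_dev_reflection_const_ge A s :
  n.+1%:R * (n.+1%:R - 2 - \sum_i A i (s i)) + 2 * total A <= n.+1%:R * cheb_dev A.
Proof.
have := cheb_dev_reflection_ge A s (const_mx 1).
have -> : dot (const_mx 1) (const_mx 1 : 'rV[R]_n.+1) = n.+1%:R.
  by rewrite /dot; under eq_bigr do rewrite !mxE mulr1; rewrite sumr_const card_ord.
apply: le_trans; rewrite lerD2l -(sum_const_form A s) ler_pM2l //.
by apply: ler_sum => i _; apply: ler_sum => j _; rewrite !mxE.
Qed.

Lemma cheb_dev_total_le A : n.+1%:R - 2 + total A / n.+1%:R <= cheb_dev A.
Proof.
have n0 : 0 < n.+1%:R :> R by rewrite ltr0n.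
(* One factor is the squared length of the all-ones vector, the other the number of cyclic
   shifts. *)
rewrite -(ler_pM2l n0) -(ler_pM2l n0).
have : \sum_(k < n.+1) (n.+1%:R *
      (n.+1%:R - 2 - \sum_i A i ((perm (addrI k) * 1)%g i)) + 2 * total A) <=
    \sum_(k < n.+1) n.+1%:R * cheb_dev A.
  by apply: ler_sum => k _; exact: cheb_dev_reflection_const_ge.
rewrite big_split /= -mulr_sumr sumrB sum_shift !sum_const_ord -/(total A).
apply: le_trans; rewrite le_eqVlt; apply/orP; left; apply/eqP.
by field; rewrite -mulrS pnatr_eq0.
Qed.

Lemma cheb_dev_ge A : n.+1%:R - 1 <= cheb_dev A.
Proof.
have := cheb_dev_total_ge A; have := cheb_dev_total_le A.
by move: (total A / _) => x; lra.
Qed.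

(** The first-order condition at the minimum [t = 0], obtained by evaluation at one point instead of
    differentiation. *)
Lemma linear_coef_eq0 (a b : R) : (forall t, 0 <= a * t + b * t ^+ 2) -> a = 0.
Proof.
move=> ge0; apply/eqP; rewrite -sqrf_eq0 eq_le sqr_ge0 andbT.
have c0 : 0 < 1 + `|b| by rewrite ltr_wpDr.
(* A step against the sign of [a], short enough for the linear term to dominate: since [1 + |b| - b]
   is at least 1, nonnegativity forces [a ^+ 2 <= 0]. *)
have := ge0 (- a / (1 + `|b|)).
have -> : a * (- a / (1 + `|b|)) + b * (- a / (1 + `|b|)) ^+ 2 =
    - (a ^+ 2 * (1 + (`|b| - b))) / (1 + `|b|) ^+ 2.
  by field; exact: lt0r_neq0.
rewrite pmulr_lge0 ?invr_gt0 ?exprn_gt0 // oppr_ge0; apply: le_trans.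
by rewrite ler_peMr ?sqr_ge0 // lerDl subr_ge0 ler_norm.
Qed.

Lemma sum_delta (I : finType) (k : I) (F : I -> R) :
  \sum_i (i == k)%:R * F i = F k.
Proof.
by rewrite (bigD1 k) //= eqxx mul1r big1 ?addr0 // => i /negbTE ->; rewrite mul0r.
Qed.

(** * Uniqueness: matrices whose deviation is at most the radius *)

Section Minimizer.
Variable A : 'M[R]_n.+1.
Hypothesis devA : cheb_dev A <= n.+1%:R - 1.

Let N_neq0 : n.+1%:R != 0 :> R. Proof. by rewrite pnatr_eq0. Qed.

Lemma minimizer_total : total A = n.+1%:R.
Proof.
have := cheb_dev_total_ge A; have := cheb_dev_total_le A => h1 h2.
have : total A / n.+1%:R = 1 by move: (total A / _) h1 h2 => x; move: devA; lra.
by move/(canRL (divfK N_neq0)); rewrite mul1r.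
Qed.

(** Each such sum is at least 1, and the sums over the [n + 1] cyclic shifts of [s] add up to
    [n + 1], so all equal 1; the shift by 0 is [s] itself. *)
Lemma minimizer_diagonal s : \sum_i A i (s i) = 1.
Proof.
have ge1 s' : 0 <= \sum_i A i (s' i) - 1.
  by have := le_trans (cheb_dev_perm_ge A s') devA; move: (\sum_i _) => x; lra.
have : \sum_k (\sum_i A i ((perm (addrI k) * s)%g i) - 1) = 0.
  rewrite sumrB sum_shift -/(total A) minimizer_total sumr_const card_ord.
  by rewrite subrr.
move/eqP; rewrite psumr_eq0 => [/allP/(_ 0)|k _]; last exact: ge1.
rewrite mem_index_enum subr_eq0 => /(_ isT)/eqP <-.
by apply: eq_bigr => i _; rewrite permM permE add0r.
Qed.

Lemma minimizer_form_le s (v : 'rV[R]_n.+1) :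
  \sum_i \sum_j v 0 i * A i (s j) * v 0 j <= dot v v.
Proof.
have := cheb_dev_reflection_ge A s v; rewrite minimizer_diagonal => h.
have := ler_wpM2l (dot_ge0 v) devA; set Q := \sum_i _ in h *.
move: h; lra.
Qed.

Lemma minimizer_row_col k l : \sum_j A k j + \sum_i A i l = 2.
Proof.
(* Any permutation with [s k = l] would make the perturbation at [k] pick out row [k] and column
   [l]. *)
pose s := tperm k l; pose d i : R := (i == k)%:R.
have rowE : \sum_j A k (s j) = \sum_j A k j.
  by rewrite [RHS](reindex_inj (@perm_inj _ s)).
have sk : s k = l by rewrite tpermL.
apply/eqP; rewrite -subr_eq0 -oppr_eq0; apply/eqP.
(* For [v = 1 + t d], the slack in [minimizer_form_le] is a quadratic in [t] without constant term;
   its linear coefficient is 2 minus the two sums, its quadratic one [1 - A k l]. *)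
apply: (@linear_coef_eq0 _ (1 - A k l)) => t.
pose v : 'rV[R]_n.+1 := \row_i (1 + t * d i).
have := minimizer_form_le s v.
have -> : dot v v = n.+1%:R + 2 * t + t ^+ 2.
  transitivity (\sum_i (1 + 2 * t * (d i * 1) + t ^+ 2 * (d i * d i))).
    by apply: eq_bigr => i _; rewrite !mxE; ring.
  rewrite !big_split /= -!mulr_sumr !sum_delta /d eqxx !mulr1.
  by rewrite sumr_const card_ord.
have -> : \sum_i \sum_j v 0 i * A i (s j) * v 0 j =
    n.+1%:R + t * (\sum_j A k j + \sum_i A i l) + t ^+ 2 * A k l.
  transitivity (\sum_i (\sum_j 1 * A i (s j) * 1 + t * A i l
      + d i * (t * \sum_j A k (s j) + t ^+ 2 * A k l))).
    apply: eq_bigr => i _.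
    transitivity (\sum_j 1 * A i (s j) * 1 + t * (1 + t * d i) * A i l
        + t * d i * \sum_j A i (s j)).
      rewrite -sk -(sum_delta k (fun j => A i (s j))) !mulr_sumr -!big_split /=.
      apply: eq_bigr => j _; rewrite !mxE /d; ring.
    rewrite /d; have [->|_] := eqVneq i k; rewrite /=; ring.
  rewrite !big_split /= sum_const_form minimizer_total -mulr_sumr sum_delta rowE.
  by ring.
lra.
Qed.

Lemma minimizer_row k : \sum_j A k j = 1.
Proof.
have : \sum_l (\sum_j A k j + \sum_i A i l) = \sum_(l < n.+1) 2.
  by apply: eq_bigr => l _; exact: minimizer_row_col.
rewrite big_split /= !sum_const_ord exchange_big -/(total A) minimizer_total.
by rewrite -[X in _ + X]mulr1 -mulrDr => /(mulfI N_neq0); lra.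
Qed.

Lemma minimizer_col l : \sum_i A i l = 1.
Proof. by have := minimizer_row_col l l; rewrite minimizer_row; lra. Qed.

(** Two permutations that differ by the transposition of [i] and [k] have equal diagonal sums, and
    these differ only in the rows [i] and [k]. *)
Lemma minimizer_exchange i j k l : A i j + A k l = A i l + A k j.
Proof.
have [->|ik] := eqVneq i k; first by rewrite addrC.
have [->|jl] := eqVneq j l; first by [].
have [s [si sk]] : exists s : 'S_n.+1, s i = j /\ s k = l.
  have tj : tperm i j k != j.
    by apply: contra_neq ik => e; rewrite -(tpermK i j k) e tpermR.
  (* First move [i] to [j], then the image of [k] to [l]; the second transposition fixes [j]. *)
  exists (tperm i j * tperm (tperm i j k) l)%g.
  split; rewrite permM; last exact: tpermL.
  by rewrite tpermL (tpermD tj) // eq_sym.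
have := minimizer_diagonal s; rewrite -(minimizer_diagonal (tperm i k * s)%g).
have ki : k != i by rewrite eq_sym.
have split2 (s' : 'S_n.+1) : \sum_m A m (s' m) = A i (s' i) + (A k (s' k) +
    \sum_(m | (m != i) && (m != k)) A m (s' m)) by rewrite (bigD1 i) //= (bigD1 k).
rewrite !split2 !permM tpermL tpermR si sk.
under [X in _ = _ + (_ + X)]eq_bigr => m /andP[mi mk]
  do rewrite permM tpermD 1?eq_sym //.
by move: (\sum_(_ | _) _) => x; lra.
Qed.

Lemma minimizer_eq : A = Jmat R n.+1.
Proof.
apply/matrixP=> i j; rewrite mxE.
(* With all row and column sums equal to 1, this summed identity reads [N^2 * A i j + N = N + N] for
   [N = n + 1]. *)
have : \sum_k \sum_l (A i j + A k l) = \sum_k \sum_l (A i l + A k j).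
  by do 2!apply: eq_bigr => ? _; exact: minimizer_exchange.
under eq_bigr do rewrite big_split /= sum_const_ord.
under [RHS]eq_bigr do rewrite big_split /= sum_const_ord minimizer_row.
rewrite !big_split /= !sum_const_ord -/(total A) minimizer_total.
rewrite -mulr_sumr minimizer_col => h.
apply: (mulIf N_neq0); apply: (mulIf N_neq0); rewrite mulVf //; lra.
Qed.

End Minimizer.
End Deviation.

(** * The Chebyshev radius and center *)

Lemma cheb_dev_Jmat (R : realType) n : cheb_dev (Jmat R n.+1) = n.+1%:R - 1.
Proof. by apply/eqP; rewrite eq_le cheb_dev_Jmat_le // cheb_dev_ge. Qed.

Lemma cheb_radiusE (R : realType) n : cheb_radius R n.+1 = n.+1%:R - 1.
Proof.
apply/eqP; rewrite eq_le; apply/andP; split.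
  rewrite -cheb_dev_Jmat; apply: ge_inf; last by exists (Jmat R n.+1).
  by exists (n.+1%:R - 1) => _ [A _ <-]; exact: cheb_dev_ge.
apply: lb_le_inf; first by exists (cheb_dev (Jmat R n.+1)), (Jmat R n.+1).
by move=> _ [A _ <-]; exact: cheb_dev_ge.
Qed.

Unset Implicit Arguments.

Theorem mainTheorem8 (R : realType) (n : nat) (hn : (0 < n)%N) :
  cheb_radius R n = n%:R - 1 /\
  (forall A : 'M[R]_n, cheb_dev A = cheb_radius R n <-> A = Jmat R n).
Proof.
case: n hn => // n _; rewrite cheb_radiusE; split=> // A.
split=> [devA|->]; last exact: cheb_dev_Jmat.
by apply: minimizer_eq; rewrite devA.
Qed.
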